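(* Let $n\ge 3$, let $(A,\Lambda)$ be a form ring and let $(I,\Gamma)$ and $(J,\Delta)$ be form ideals of $(A,\Lambda)$. Then $$\big[\mathrm{GU}(2n,I,\Gamma),\mathrm{GU}(2n,J,\Delta)\big]\subseteq\mathrm{GU}\big(2n,(I,\Gamma)\circ(J,\Delta)\big).$$
   Context: Form rings. $A$ is an associative (not necessarily commutative) ring with $1$ with an involution $a\mapsto\bar a$ (additive, $\overline{ab}=\bar b\bar a$, $\bar{\bar a}=a$). Fix $\lambda\in\mathrm{Cent}(A)$ with $\lambda\bar\lambda=1$. Put $\Lambda_{\min}=\{a-\lambda\bar a: a\in A\}$, $\Lambda_{\max}=\{a\in A: a=-\lambda\bar a\}$. A form parameter is an additive subgroup $\Lambda$ with $\Lambda_{\min}\subseteq\Lambda\subseteq\Lambda_{\max}$ and $a\Lambda\bar a\subseteq\Lambda$ for all $a\in A$; $(A,\Lambda)$ is then a form ring. Form ideals. For a two-sided ideal $I$ with $\bar I=I$ put $\Gamma_{\max}(I)=I\cap\Lambda$ and $\Gamma_{\min}(I)=\{\xi-\lambda\bar\xi:\xi\in I\}+\langle\xi\alpha\bar\xi:\xi\in I,\alpha\in\Lambda\rangle$ ($\langle\cdot\rangle$ = additive subgroup generated). A relative form parameter of level $I$ is an additive subgroup $\Gamma$ with $\Gamma_{\min}(I)\subseteq\Gamma\subseteq\Gamma_{\max}(I)$ and $a\Gamma\bar a\subseteq\Gamma$ for all $a\in A$; then $(I,\Gamma)$ is a form ideal. The symmetrised product of form ideals is $$(I,\Gamma)\circ(J,\Delta)=\big(IJ+JI,\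 \Gamma_{\min}(IJ+JI)+{}^J\Gamma+{}^I\Delta\big),$$ where ${}^J\Gamma=\langle\xi\gamma\bar\xi:\xi\in J,\gamma\in\Gamma\rangle$ and ${}^I\Delta=\langle\xi\delta\bar\xi:\xi\in I,\delta\in\Delta\rangle$. Unitary groups. Index coordinates of $V=A^{2n}$ (right module of columns) by $\{1,\dots,n,-n,\dots,-1\}$. Let $f(u,v)=\bar u_1v_{-1}+\dots+\bar u_nv_{-n}$, $h(u,v)=f(u,v)+\lambda\overline{f(v,u)}$, $q(u)=f(u,u)\bmod\Lambda$. $\mathrm{GU}(2n,A,\Lambda)$ is the group of $g\in\mathrm{GL}(2n,A)$ with $h(gu,gv)=h(u,v)$ and $q(gu)=q(u)$ for all $u,v\in V$. For a form ideal $(I,\Gamma)$, the principal congruence subgroup $\mathrm{GU}(2n,I,\Gamma)$, also written $\mathrm{GU}(2n,(I,\Gamma))$, is the group of $g\in\mathrm{GU}(2n,A,\Lambda)$ congruent to the identity modulo $I$ with $f(gu,gu)\in f(u,u)+\Gamma$ for all $u\in V$. For subgroups $H,K$, $[H,K]$ is the subgroup generated by all $xyx^{-1}y^{-1}$, $x\in H$, $y\in K$. *)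

(* Defs.v *)
From HB Require Import structures.
From mathcomp Require Import all_boot all_order all_algebra.
From mathcomp Require Import boolp classical_sets.

Set Implicit Arguments.
Unset Strict Implicit.
Unset Printing Implicit Defensive.

Import GRing.Theory.
Local Open Scope classical_set_scope.
Local Open Scope ring_scope.

Section Subgroups.
Context {V : zmodType}.
Implicit Types S T : set V.

Definition addgen S : set V := smallest (fun T => zmod_closed [in T]) S.

Definition addsum S T : set V := [set x + y | x in S & y in T].

Lemma zmod_setP S :
  zmod_closed [in S] <-> S 0 /\ (forall x y, S x -> S y -> S (x - y)).
Proof.
split=> -[S0 SB]; split; first exact: set_mem S0.
- by move=> x y /mem_set Sx /mem_set Sy; apply/set_mem/SB.
- exact: mem_set S0.
- by move=> x y /set_mem Sx /set_mem Sy; apply/mem_set/SB.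
Qed.

Lemma zmod_setD S x y : zmod_closed [in S] -> S x -> S y -> S (x + y).
Proof.
move=> /zmod_setP[S0 SB] Sx Sy.
by rewrite -[y]opprK -[- y]sub0r; apply: (SB) => //; apply: SB.
Qed.

Lemma addgen_zmod S : zmod_closed [in addgen S].
Proof.
apply/zmod_setP; split=> [T [/zmod_setP[]]//|x y Sx Sy T [Tz ST]].
by case/zmod_setP: (Tz) => _; apply; [apply: Sx|apply: Sy].
Qed.

Lemma sub_addgen S : S `<=` addgen S.
Proof. exact: sub_gen_smallest. Qed.

Lemma addgen_min S T : zmod_closed [in T] -> S `<=` T -> addgen S `<=` T.
Proof. exact: smallest_sub. Qed.

Lemma addsum_zmod S T :
  zmod_closed [in S] -> zmod_closed [in T] -> zmod_closed [in addsum S T].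
Proof.
move=> /zmod_setP[S0 SB] /zmod_setP[T0 TB]; apply/zmod_setP; split.
  by exists 0 => //; exists 0; rewrite // addr0.
move=> _ _ [x Sx [y Ty <-]] [x' Sx' [y' Ty' <-]].
by exists (x - x'); [exact: SB|exists (y - y'); [exact: TB|rewrite opprD addrACA]].
Qed.

Lemma addsum_l S T : zmod_closed [in T] -> S `<=` addsum S T.
Proof. by move=> /zmod_setP[T0 _] x Sx; exists x => //; exists 0; rewrite ?addr0. Qed.

Lemma addsum_r S T : zmod_closed [in S] -> T `<=` addsum S T.
Proof. by move=> /zmod_setP[S0 _] x Tx; exists 0 => //; exists x; rewrite ?add0r. Qed.

Lemma addsum_min S T U :
  zmod_closed [in U] -> S `<=` U -> T `<=` U -> addsum S T `<=` U.
Proof.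
by move=> Uz SU TU _ [x /SU Ux [y /TU Uy <-]]; apply: zmod_setD.
Qed.

End Subgroups.

Lemma preim_zmod (V W : zmodType) (phi : V -> W) (T : set W) :
  {morph phi : x y / x - y} -> zmod_closed [in T] ->
  zmod_closed [in phi @^-1` T].
Proof.
move=> phiB /zmod_setP[T0 TB]; apply/zmod_setP; split=> [|x y Tx Ty] /=.
  by rewrite -(subrr 0) phiB subrr.
by rewrite phiB; apply: TB.
Qed.

(* The underlying ring may be the zero ring, whence pzRingType. *)
Record formRing := FormRing {
  form_ring_sort :> pzRingType;
  bar : form_ring_sort -> form_ring_sort;
  barD : {morph bar : a b / a + b};
  barM : forall a b, bar (a * b) = bar b * bar a;
  barK : involutive bar;
  lam : form_ring_sort;
  lam_central : forall a, lam * a = a * lam;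
  lam_bar : lam * bar lam = 1;
  Lam : set form_ring_sort;
  Lam_zmod : zmod_closed [in Lam];
  Lam_min : [set a - lam * bar a | a in setT] `<=` Lam;
  Lam_max : Lam `<=` [set a | a = - (lam * bar a)];
  Lam_conj : forall a x, Lam x -> Lam (a * x * bar a) }.

Arguments bar {f} _.
Arguments lam {f}.
Arguments Lam {f} _.

Section FormIdeals.
Context {A : formRing}.
Implicit Types (a x : A) (I J G D : set A).

Definition two_sided_ideal I :=
  zmod_closed [in I] /\ forall a x, I x -> I (a * x) /\ I (x * a).

(* conj_span J G is the subgroup written with J as left superscript of G. *)
Definition conj_span J G : set A :=
  addgen [set x * g * bar x | x in J & g in G].

Definition Gamma_max I : set A := I `&` Lam.

Definition Gamma_min I : set A :=
  addsum [set x - lam * bar x | x in I] (conj_span I Lam).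

Definition ideal_prod I J : set A := addgen [set x * y | x in I & y in J].

Definition sym_ideal I J : set A := addsum (ideal_prod I J) (ideal_prod J I).

Definition sym_param I G J D : set A :=
  addsum (addsum (Gamma_min (sym_ideal I J)) (conj_span J G)) (conj_span I D).

End FormIdeals.

Record formIdeal (A : formRing) := FormIdeal {
  fideal : set A;
  fideal_ideal : two_sided_ideal fideal;
  fideal_bar : bar @` fideal = fideal;
  fparam : set A;
  fparam_zmod : zmod_closed [in fparam];
  fparam_min : Gamma_min fideal `<=` fparam;
  fparam_max : fparam `<=` Gamma_max fideal;
  fparam_conj : forall a x, fparam x -> fparam (a * x * bar a) }.

Section SymmetrisedProduct.
Context {A : formRing}.
Implicit Types (a x : A) (I J G D : set A) (X Y : formIdeal A).

Lemma bar0 : bar 0 = 0 :> A.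
Proof. by apply: (addrI (bar 0)); rewrite -barD !addr0. Qed.

Lemma barN : {morph @bar A : x / - x}.
Proof. by move=> x; apply: (addrI (bar x)); rewrite -barD !subrr bar0. Qed.

Lemma barB : {morph @bar A : x y / x - y}.
Proof. by move=> x y; rewrite barD barN. Qed.

Lemma fideal_barP X x : fideal X x -> fideal X (bar x).
Proof. by move=> Xx; rewrite -(fideal_bar X); exists x. Qed.

Lemma ideal_prod_ideal I J :
  two_sided_ideal I -> two_sided_ideal J -> two_sided_ideal (ideal_prod I J).
Proof.
move=> [_ Ii] [_ Ji]; split=> [|a x IJx]; first exact: addgen_zmod.
split.
- have: addgen [set x * y | x in I & y in J] `<=` *%R a @^-1` ideal_prod I J.
    apply: addgen_min.
      by apply: preim_zmod (addgen_zmod _) => u v; rewrite mulrBr.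
    move=> _ [u Iu [v Jv <-]] /=; rewrite mulrA; apply: sub_addgen.
    by exists (a * u); [case: (Ii a u Iu)|exists v].
  exact.
- have: addgen [set x * y | x in I & y in J] `<=` *%R^~ a @^-1` ideal_prod I J.
    apply: addgen_min.
      by apply: preim_zmod (addgen_zmod _) => u v; rewrite mulrBl.
    move=> _ [u Iu [v Jv <-]] /=; rewrite -mulrA; apply: sub_addgen.
    by exists u => //; exists (v * a) => //; case: (Ji a v Jv).
  exact.
Qed.

Lemma sym_ideal_ideal I J :
  two_sided_ideal I -> two_sided_ideal J -> two_sided_ideal (sym_ideal I J).
Proof.
move=> Ii Ji; have [IJz IJi] := ideal_prod_ideal Ii Ji.
have [JIz JIi] := ideal_prod_ideal Ji Ii.
split=> [|a _ [x /(IJi a)[xl xr] [y /(JIi a)[yl yr] <-]]].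
  exact: addsum_zmod.
split; first by exists (a * x) => //; exists (a * y) => //; rewrite mulrDr.
by exists (x * a) => //; exists (y * a) => //; rewrite mulrDl.
Qed.

Lemma bar_ideal_prod X Y x :
  ideal_prod (fideal X) (fideal Y) x -> ideal_prod (fideal Y) (fideal X) (bar x).
Proof.
move: x; apply: addgen_min; first exact: preim_zmod barB (addgen_zmod _).
move=> _ [u Xu [v Yv <-]] /=; rewrite barM; apply: sub_addgen.
by exists (bar v); [exact: fideal_barP|exists (bar u) => //; exact: fideal_barP].
Qed.

Lemma sym_ideal_bar X Y :
  bar @` sym_ideal (fideal X) (fideal Y) = sym_ideal (fideal X) (fideal Y).
Proof.
have sub x : sym_ideal (fideal X) (fideal Y) x ->
             sym_ideal (fideal X) (fideal Y) (bar x).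
  case=> u /bar_ideal_prod u' [v /bar_ideal_prod v' <-].
  by exists (bar v) => //; exists (bar u) => //; rewrite barD addrC.
apply/seteqP; split=> [_ [x /sub Sx <-]//|x /sub Sx].
by exists (bar x) => //; rewrite barK.
Qed.

Lemma conj_span_conj I G a x : two_sided_ideal I ->
  conj_span I G x -> conj_span I G (a * x * bar a).
Proof.
move=> [_ Ii]; move: x; apply: addgen_min.
  by apply: (preim_zmod (phi := fun x => a * x * bar a)) (addgen_zmod _) => u v;
     rewrite mulrBr mulrBl.
move=> _ [u Iu [g Gg <-]] /=; apply: sub_addgen.
exists (a * u); first by case: (Ii a u Iu).
by exists g => //; rewrite barM !mulrA.
Qed.

Lemma Gamma_min_zmod I : zmod_closed [in I] -> zmod_closed [in Gamma_min I].
Proof.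
move=> /zmod_setP[I0 IB]; apply: addsum_zmod; last exact: addgen_zmod.
apply/zmod_setP; split; first by exists 0; rewrite ?bar0 ?mulr0 ?subrr.
move=> _ _ [x Ix <-] [y Iy <-]; exists (x - y); first exact: IB.
by rewrite barB mulrBr !opprB addrACA [RHS]addrACA; congr (_ + _); rewrite addrC.
Qed.

Lemma Gamma_min_conj I a x : two_sided_ideal I ->
  Gamma_min I x -> Gamma_min I (a * x * bar a).
Proof.
move=> Ii [_ [u Iu <-] [v /(conj_span_conj a Ii) Gv <-]].
exists (a * (u - lam * bar u) * bar a); last first.
  by exists (a * v * bar a) => //; rewrite [in RHS]mulrDr [in RHS]mulrDl.
exists (a * u * bar a).
  by case: Ii => _ Ii; exact: (Ii _ _ (Ii _ _ Iu).1).2.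
by rewrite !barM barK mulrBr mulrBl !mulrA lam_central.
Qed.

Lemma Gamma_max_zmod I : zmod_closed [in I] -> zmod_closed [in Gamma_max I].
Proof.
have /zmod_setP[L0 LB] := Lam_zmod A.
move=> /zmod_setP[I0 IB]; apply/zmod_setP; split=> // x y [? ?] [? ?].
by split; [apply: IB|apply: LB].
Qed.

Lemma Gamma_min_max I : two_sided_ideal I -> (forall x, I x -> I (bar x)) ->
  Gamma_min I `<=` Gamma_max I.
Proof.
move=> [Iz Ii] Ibar; have /zmod_setP[_ IB] := Iz.
apply: addsum_min; first exact: Gamma_max_zmod.
  move=> _ [x Ix <-]; split; last by apply: Lam_min; exists x.
  by apply: IB => //; case: (Ii lam (bar x) (Ibar _ Ix)).
apply: addgen_min; first exact: Gamma_max_zmod.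
move=> _ [x Ix [g Lg <-]]; split; last exact: Lam_conj.
by case: (Ii (g * bar x) x Ix); rewrite mulrA.
Qed.

Lemma sym_param_zmod X Y :
  zmod_closed [in sym_param (fideal X) (fparam X) (fideal Y) (fparam Y)].
Proof.
apply: addsum_zmod; last exact: addgen_zmod.
apply: addsum_zmod; last exact: addgen_zmod.
apply: Gamma_min_zmod.
by case: (sym_ideal_ideal (fideal_ideal X) (fideal_ideal Y)).
Qed.

Lemma sym_param_min X Y :
  Gamma_min (sym_ideal (fideal X) (fideal Y)) `<=`
  sym_param (fideal X) (fparam X) (fideal Y) (fparam Y).
Proof.
apply: subset_trans (addsum_l (addgen_zmod _)).
exact: addsum_l (addgen_zmod _).
Qed.

Lemma sym_param_max X Y :
  sym_param (fideal X) (fparam X) (fideal Y) (fparam Y) `<=`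
  Gamma_max (sym_ideal (fideal X) (fideal Y)).
Proof.
have [XX YY] := (fideal_ideal X, fideal_ideal Y).
have SI := sym_ideal_ideal XX YY; have SIz := SI.1.
have Sz := Gamma_max_zmod SIz.
apply: (addsum_min Sz); [apply: (addsum_min Sz)|].
- apply: Gamma_min_max => // x Sx.
  by rewrite -sym_ideal_bar; exists x.
- apply: (addgen_min Sz) => _ [x Yx [g Xg <-]].
  have [Xg1 Lg] := fparam_max Xg; split; last exact: Lam_conj.
  have SYX : sym_ideal (fideal X) (fideal Y) (x * g).
    apply: addsum_r; first exact: addgen_zmod.
    by apply: sub_addgen; exists x => //; exists g.
  by case: (SI.2 (bar x) _ SYX).
- apply: (addgen_min Sz) => _ [x Xx [g Yg <-]].
  have [Yg1 Lg] := fparam_max Yg; split; last exact: Lam_conj.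
  have SXY : sym_ideal (fideal X) (fideal Y) (x * g).
    apply: addsum_l; first exact: addgen_zmod.
    by apply: sub_addgen; exists x => //; exists g.
  by case: (SI.2 (bar x) _ SXY).
Qed.

Lemma sym_param_conj X Y a x :
  sym_param (fideal X) (fparam X) (fideal Y) (fparam Y) x ->
  sym_param (fideal X) (fparam X) (fideal Y) (fparam Y) (a * x * bar a).
Proof.
have SI := sym_ideal_ideal (fideal_ideal X) (fideal_ideal Y).
case=> _ [u /(Gamma_min_conj a SI) Gu [v /(conj_span_conj a (fideal_ideal Y)) Gv <-]].
case=> w /(conj_span_conj a (fideal_ideal X)) Gw <-.
exists (a * (u + v) * bar a); last first.
  by exists (a * w * bar a) => //; rewrite [in RHS]mulrDr [in RHS]mulrDl.
exists (a * u * bar a) => //.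
by exists (a * v * bar a) => //; rewrite [in RHS]mulrDr [in RHS]mulrDl.
Qed.

Definition fi_symprod X Y : formIdeal A := {|
  fideal := sym_ideal (fideal X) (fideal Y);
  fideal_ideal := sym_ideal_ideal (fideal_ideal X) (fideal_ideal Y);
  fideal_bar := sym_ideal_bar X Y;
  fparam := sym_param (fideal X) (fparam X) (fideal Y) (fparam Y);
  fparam_zmod := @sym_param_zmod X Y;
  fparam_min := @sym_param_min X Y;
  fparam_max := @sym_param_max X Y;
  fparam_conj := @sym_param_conj X Y |}.

End SymmetrisedProduct.

(* An element of GL m A is a matrix paired with its two-sided inverse: the    *)
(* library's unitmx and 'GL_n require a commutative (resp. finite) ring.      *)
Section GeneralLinearGroup.
Variables (m : nat) (A : pzRingType).

Definition inverse_pair : pred ('M[A]_m * 'M[A]_m) :=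
  fun p => (p.1 *m p.2 == 1%:M) && (p.2 *m p.1 == 1%:M).

Record GL := MkGL { gl_pair : 'M[A]_m * 'M[A]_m; _ : inverse_pair gl_pair }.

HB.instance Definition _ := [isSub for gl_pair].
HB.instance Definition _ := [Choice of GL by <:].

Lemma gl_mulmxV (g : GL) : (gl_pair g).1 *m (gl_pair g).2 = 1%:M.
Proof. by case/andP: (valP g) => /eqP. Qed.

Lemma gl_mulVmx (g : GL) : (gl_pair g).2 *m (gl_pair g).1 = 1%:M.
Proof. by case/andP: (valP g) => _ /eqP. Qed.

Lemma gl_eqP (g h : GL) : (gl_pair g).1 = (gl_pair h).1 -> g = h.
Proof.
move=> e; apply: val_inj => /=; rewrite [LHS]surjective_pairing e.
rewrite [RHS]surjective_pairing; congr pair.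
by rewrite -[LHS]mulmx1 -(gl_mulmxV h) -e mulmxA gl_mulVmx mul1mx.
Qed.

Lemma gl_one_subproof : inverse_pair (1%:M, 1%:M).
Proof. by rewrite /inverse_pair /= mulmx1 eqxx. Qed.
Definition gl_one := MkGL gl_one_subproof.

Lemma gl_inv_subproof (g : GL) : inverse_pair ((gl_pair g).2, (gl_pair g).1).
Proof. by rewrite /inverse_pair /= gl_mulmxV gl_mulVmx eqxx. Qed.
Definition gl_inv g := MkGL (gl_inv_subproof g).

Lemma gl_mul_subproof (g h : GL) :
  inverse_pair ((gl_pair g).1 *m (gl_pair h).1, (gl_pair h).2 *m (gl_pair g).2).
Proof.
apply/andP; split; apply/eqP; rewrite /= mulmxA.
  by rewrite -[(_ *m _) *m (gl_pair h).2]mulmxA gl_mulmxV mulmx1 gl_mulmxV.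
by rewrite -[(_ *m _) *m (gl_pair g).1]mulmxA gl_mulVmx mulmx1 gl_mulVmx.
Qed.
Definition gl_mul g h := MkGL (gl_mul_subproof g h).

Lemma gl_mulA : associative gl_mul.
Proof. by move=> g h k; apply: gl_eqP; rewrite /= mulmxA. Qed.
Lemma gl_mul1g : left_id gl_one gl_mul.
Proof. by move=> g; apply: gl_eqP; rewrite /= mul1mx. Qed.
Lemma gl_mulg1 : right_id gl_one gl_mul.
Proof. by move=> g; apply: gl_eqP; rewrite /= mulmx1. Qed.
Lemma gl_mulVg : left_inverse gl_one gl_inv gl_mul.
Proof. by move=> g; apply: gl_eqP; rewrite /= gl_mulVmx. Qed.
Lemma gl_mulgV : right_inverse gl_one gl_inv gl_mul.
Proof. by move=> g; apply: gl_eqP; rewrite /= gl_mulmxV. Qed.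

HB.instance Definition _ :=
  isGroup.Build GL gl_mulA gl_mul1g gl_mulg1 gl_mulVg gl_mulgV.

Definition gl_mx (g : GL) : 'M[A]_m := (gl_pair g).1.

End GeneralLinearGroup.

Coercion gl_mx : GL >-> matrix.

(* Commutators are x y x^-1 y^-1; the library's [~ x, y] is x^-1 y^-1 x y.     *)
Definition comm_subgroup (G : groupType) (H K : set G) : set G :=
  smallest (fun S => group_closed [in S])
    [set (x * y * x^-1 * y^-1)%g | x in H & y in K].

Section UnitaryGroups.
Context {A : formRing}.
Variable n : nat.

(* 'I_(n + n) enumerates the indices 1, ..., n, -n, ..., -1 in this order, so *)
(* that i : 'I_n stands for i + 1 and the index -(i + 1) sits at position     *)
(* n + (n - 1 - i).                                                           *)
Definition pos_idx (i : 'I_n) : 'I_(n + n) := lshift n i.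
Definition neg_idx (i : 'I_n) : 'I_(n + n) := rshift n (rev_ord i).

Implicit Types u v : 'cV[A]_(n + n).

Definition form_f u v : A :=
  \sum_(i < n) bar (u (pos_idx i) 0) * v (neg_idx i) 0.

Definition form_h u v : A := form_f u v + lam * bar (form_f v u).

(* The class of f(u,u) modulo Lam, as a coset. *)
Definition form_q u : set A := [set form_f u u + x | x in Lam].

Definition GU : set (GL (n + n) A) :=
  [set g | (forall u v, form_h (g *m u) (g *m v) = form_h u v) /\
           (forall u, form_q (g *m u) = form_q u)].

Definition GU_congr (X : formIdeal A) : set (GL (n + n) A) :=
  [set g | [/\ GU g,
     forall i j, fideal X ((gl_mx g - 1%:M) i j) &
     forall u, [set form_f u u + x | x in fparam X] (form_f (g *m u) (g *m u))]].

End UnitaryGroups.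

Arguments GU {A} n.
Arguments GU_congr {A} n X.

(* Main.v *)
Require Import Defs.
From mathcomp Require Import all_boot all_order all_algebra.
From mathcomp Require Import boolp classical_sets.

(** For a matrix g let d_g(u) = f(gu,gu) - f(u,u) be its defect at u, and write
    K = IJ + JI and T for the form parameter of (I,Gamma) o (J,Delta).  Since
    GU(2n,(I,Gamma) o (J,Delta)) is a group ([GU_congr_group]), only a single
    commutator c of g in GU(2n,I,Gamma) and k in GU(2n,J,Delta) matters.
    Modulo K it is the identity, because
      c - 1 = ((g - 1)(k - 1) - (k - 1)(g - 1)) g^-1 k^-1.
    The remaining point is that every defect of c lies in T.  As u = kgw with
    w = (kg)^-1 u, and c carries kgw to gkw, additivity of defects along
    products gives
      d_c(u) = (d_g(kw) - d_g(w)) - (d_k(gw) - d_k(w)),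
    and both brackets lie in T for the same reason ([defect_shift_in]), the
    symmetrised product being symmetric.

    For the first bracket, kw = w + v where v has its entries in J.  Because g
    preserves h, the defect d_g is additive up to z - lam * bar z, where
    z = f(gv,gw) - f(v,w) ([defectD]).  As g is the identity modulo I and v
    vanishes modulo J, z lies in K, so this correction lies in Gamma_min(K).
    It remains to see that d_g(v) is in T: expand v in the standard basis;
    up to the same kind of correction d_g(v) is the sum of the
    bar(v_i) * d_g(e_i) * v_i, and these lie in the conjugate span of Gamma by
    J since d_g(e_i) is in Gamma ([defect_in]). *)

Local Open Scope classical_set_scope.

(** * Additive subgroups *)

Section AdditiveSubgroups.
Set Implicit Arguments.
Unset Strict Implicit.
Import GRing.Theory.
Local Open Scope ring_scope.

Lemma zmod_set_sum (V : zmodType) (S : set V) (I : finType) (F : I -> V) :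
  zmod_closed [in S] -> (forall i, S (F i)) -> S (\sum_i F i).
Proof.
move=> Sz SF; apply: big_ind => //; first by case/zmod_setP: Sz.
by move=> x y; apply: zmod_setD.
Qed.

Lemma addsumC (V : zmodType) (S T : set V) : addsum S T = addsum T S.
Proof.
by apply/seteqP; split=> _ [x Sx [y Ty <-]]; exists y => //; exists x;
  rewrite // addrC.
Qed.

Lemma addsumAC (V : zmodType) (S T U : set V) :
  addsum (addsum S T) U = addsum (addsum S U) T.
Proof.
by apply/seteqP; split=> _ [_ [x Sx [y Ty <-]] [z Uz <-]];
  (exists (x + z); first by exists x => //; exists z);
  exists y; rewrite // addrAC.
Qed.

Lemma mulmx_in (A : pzRingType) (S : set A) (m p q : nat)
    (M : 'M[A]_(m, p)) (N : 'M[A]_(p, q)) :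
  zmod_closed [in S] -> (forall i j k, S (M i k * N k j)) ->
  forall i j, S ((M *m N) i j).
Proof. by move=> Sz SMN i j; rewrite mxE; apply: zmod_set_sum => // k. Qed.

End AdditiveSubgroups.

(** * Form ideals and their symmetrised product *)

Section FormIdealFacts.
Set Implicit Arguments.
Unset Strict Implicit.
Import GRing.Theory.
Local Open Scope ring_scope.
Context {A : formRing}.
Implicit Types (X Y : formIdeal A) (a x y : A).

Lemma fideal_zmod X : zmod_closed [in fideal X].
Proof. by case: (fideal_ideal X). Qed.

Lemma fidealMl X a x : fideal X x -> fideal X (a * x).
Proof. by case: (fideal_ideal X) => _ Xi /(Xi a)[]. Qed.

Lemma fidealMr X a x : fideal X x -> fideal X (x * a).
Proof. by case: (fideal_ideal X) => _ Xi /(Xi a)[]. Qed.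

Lemma fideal_mulmx X (m p q : nat) (M : 'M[A]_(m, p)) (N : 'M[A]_(p, q)) :
  (forall i j, fideal X (M i j)) -> forall i j, fideal X ((M *m N) i j).
Proof.
by move=> MX; apply: mulmx_in => [|? ? ?]; [exact: fideal_zmod | exact: fidealMr].
Qed.

Lemma fideal_symprodl X Y x y :
  fideal X x -> fideal Y y -> fideal (fi_symprod X Y) (x * y).
Proof.
move=> Xx Yy; apply: addsum_l; first exact: addgen_zmod.
by apply: sub_addgen; exists x => //; exists y.
Qed.

Lemma fideal_symprodr X Y x y :
  fideal X x -> fideal Y y -> fideal (fi_symprod X Y) (y * x).
Proof.
move=> Xx Yy; apply: addsum_r; first exact: addgen_zmod.
by apply: sub_addgen; exists y => //; exists x.
Qed.

(** Halves the work on commutators: what is shown for the defects of g shifted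
    by k also holds with the roles of the two form ideals exchanged. *)
Lemma fparam_symprodC X Y :
  fparam (fi_symprod X Y) = fparam (fi_symprod Y X).
Proof.
by rewrite /= /sym_param addsumAC /sym_ideal (addsumC (ideal_prod _ _)).
Qed.

Lemma fparam_trace X x : fideal X x -> fparam X (x - lam * bar x).
Proof.
move=> Xx; apply: fparam_min; apply: addsum_l; first exact: addgen_zmod.
by exists x.
Qed.

Lemma fparam_symprod_conj X Y x c :
  fideal Y x -> fparam X c -> fparam (fi_symprod X Y) (bar x * c * x).
Proof.
move=> Yx Xc; apply: addsum_l; first exact: addgen_zmod.
apply: addsum_r.
  by apply: Gamma_min_zmod; exact: (fideal_zmod (fi_symprod X Y)).
apply: sub_addgen; exists (bar x); first exact: fideal_barP.
by exists c; rewrite ?barK.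
Qed.

End FormIdealFacts.

(** * Defects of unitary matrices *)

Section Forms.
Set Implicit Arguments.
Unset Strict Implicit.
Import GRing.Theory.
Local Open Scope ring_scope.
Context {A : formRing} {n : nat}.
Implicit Types (X Y : formIdeal A) (u v w : 'cV[A]_(n + n)).
Implicit Types (g k : GL (n + n) A).

Lemma form_fDl u v w : form_f (u + v) w = form_f u w + form_f v w.
Proof.
rewrite /form_f -big_split; apply: eq_bigr => i _.
by rewrite mxE barD mulrDl.
Qed.

Lemma form_fDr u v w : form_f w (u + v) = form_f w u + form_f w v.
Proof.
rewrite /form_f -big_split; apply: eq_bigr => i _.
by rewrite mxE mulrDr.
Qed.

(** Scalars act on columns on the right, which over a noncommutative ring is
    multiplication by a 1 x 1 matrix and differs from the left scaling *:. *)
Lemma form_f_scale u v (a : A) :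
  form_f (u *m (a%:M : 'M_1)) (v *m (a%:M : 'M_1)) = bar a * form_f u v * a.
Proof.
rewrite /form_f mulr_sumr mulr_suml; apply: eq_bigr => i _.
by rewrite !mxE !big_ord1 !mxE mulr1n barM !mulrA.
Qed.

Lemma form_f_in (S : set A) u v :
  zmod_closed [in S] -> (forall i j, S (bar (u i 0) * v j 0)) ->
  S (form_f u v).
Proof. by move=> Sz SF; apply: zmod_set_sum. Qed.

(** Turns the coset condition on f(gu,gu) into membership of one element in
    Gamma, and this element adds up along products of matrices. *)
Definition defect g u : A := form_f (g *m u) (g *m u) - form_f u u.

Definition form_shift g u v : A := form_f (g *m u) (g *m v) - form_f u v.

(** Expanding f(g(u+v),g(u+v)) leaves the two shifts of f at (u,v) and (v,u);
    invariance of h says that the first is - lam * bar of the second, so that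
    together they form a trace element. *)
Lemma defectD g u v : GU n g ->
  defect g (u + v) = defect g u + defect g v
    + (form_shift g v u - lam * bar (form_shift g v u)).
Proof.
case=> /(_ u v) hg _; rewrite /defect mulmxDr !(form_fDl, form_fDr).
have -> : lam * bar (form_shift g v u) = - form_shift g u v.
  rewrite /form_shift barB mulrBr opprB.
  by apply/eqP; rewrite subr_eq addrAC eq_sym subr_eq -/(form_h u v) -hg addrC.
rewrite /form_shift opprK !opprD [LHS]addrACA.
rewrite [X in X + _ = _]addrACA [X in _ + X = _]addrACA.
rewrite [X in _ + X = _]addrC [LHS]addrACA.
by congr (_ + _); exact: addrC.
Qed.

Lemma defect_scale g u a :
  defect g (u *m (a%:M : 'M_1)) = bar a * defect g u * a.
Proof. by rewrite /defect mulmxA !form_f_scale mulrBr mulrBl. Qed.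

Lemma GU_congr_defect X g u : GU_congr n X g -> fparam X (defect g u).
Proof. by case=> _ _ /(_ u)[x Xx]; rewrite /defect => <-; rewrite addrC addKr. Qed.

Lemma GU_congr_split X g u : GU_congr n X g ->
  exists2 M : 'M[A]_(n + n), (forall i j, fideal X (M i j)) & g *m u = u + M *m u.
Proof.
case=> _ gX _; exists (gl_mx g - 1%:M) => //.
by rewrite mulmxBl mul1mx addrC subrK.
Qed.

(** With gv = v + Mv and gu = u + Nu the shift is f(Mv,gu) + f(v,Nu).  The
    entries of Mv lie in IJ, so the first term lies in its conjugate JI; the
    second lies in JI because f multiplies conjugates of entries of v by
    entries of Nu. *)
Lemma form_shift_in X Y g u v : GU_congr n X g -> (forall i, fideal Y (v i 0)) ->
  fideal (fi_symprod X Y) (form_shift g v u).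
Proof.
move=> gX vY; have Kz := fideal_zmod (fi_symprod X Y).
have [M MX eM] := GU_congr_split v gX; have [N NX eN] := GU_congr_split u gX.
have -> : form_shift g v u = form_f (M *m v) (g *m u) + form_f v (N *m u).
  rewrite /form_shift {1}eM form_fDl {1}eN form_fDr -(addrA (form_f v u)).
  by rewrite [LHS]addrC addKr addrC.
apply: zmod_setD => //; apply: form_f_in => // i j.
  apply: fidealMr; apply: fideal_barP; apply: mulmx_in => // {}i {}j l.
  by apply: fideal_symprodl => //; rewrite ord1.
apply: fideal_symprodr; last exact: fideal_barP.
exact: fideal_mulmx.
Qed.

Lemma defectD_in X Y g u v : GU_congr n X g -> (forall i, fideal Y (v i 0)) ->
  fparam (fi_symprod X Y) (defect g (u + v) - (defect g u + defect g v)).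
Proof.
move=> gX vY; have gU : GU n g by case: gX.
rewrite defectD // addrAC subrr add0r.
by apply: fparam_trace; apply: form_shift_in.
Qed.

Lemma cv_sum_col w :
  w = \sum_i col i (1%:M : 'M[A]_(n + n)) *m ((w i 0)%:M : 'M_1).
Proof.
apply/colP => j; rewrite summxE (bigD1 j) //= big1 => [|i ij];
  rewrite !mxE big_ord1 !mxE ?mulr1n.
  by rewrite eqxx mul1r addr0.
by rewrite eq_sym (negbTE ij) mul0r.
Qed.

(** Induction over the standard basis: every partial sum and every new summand
    has its entries in J, so all corrections to additivity are under control. *)
Lemma defect_in X Y g w : GU_congr n X g -> (forall i, fideal Y (w i 0)) ->
  fparam (fi_symprod X Y) (defect g w).
Proof.
move=> gX wY; rewrite (cv_sum_col w).
have Pz := fparam_zmod (fi_symprod X Y).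
elim/big_rec: _ => [|i u _ IH].
  by rewrite /defect mulmx0 subrr; case/zmod_setP: Pz.
set v := _ *m _; rewrite (addrC v).
have Yv j : fideal Y (v j 0).
  apply: mulmx_in => [|{}j l k]; first exact: fideal_zmod.
  rewrite (ord1 l) (ord1 k) [X in _ * X]mxE /= mulr1n.
  exact: fidealMl.
rewrite -[defect _ _](subrK (defect g u + defect g v)).
apply: zmod_setD => //; first exact: defectD_in.
apply: zmod_setD => //; rewrite defect_scale.
by apply: fparam_symprod_conj => //; apply: GU_congr_defect.
Qed.

(** The key estimate: k moves w by a vector with entries in J, and such a
    displacement changes the defect of g only inside the product parameter. *)
Lemma defect_shift_in X Y g k w : GU_congr n X g -> GU_congr n Y k ->
  fparam (fi_symprod X Y) (defect g (k *m w) - defect g w).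
Proof.
move=> gX kY; have [M MY ->] := GU_congr_split w kY.
have MwY i : fideal Y ((M *m w) i 0).
  exact: fideal_mulmx.
rewrite -[_ - _](subrK (defect g (M *m w))) -[_ - _ - _]addrA -opprD.
by apply: zmod_setD; [exact: fparam_zmod | exact: defectD_in | exact: defect_in].
Qed.

Lemma defectM g k u : defect (g * k)%g u = defect g (k *m u) + defect k u.
Proof. by rewrite /defect -mulmxA addrA subrK. Qed.

Lemma gl_mxV g : gl_mx g *m gl_mx (g^-1)%g = 1%:M.
Proof. exact: gl_mulmxV. Qed.

Lemma gl_mulmxK p g (u : 'M[A]_(n + n, p)) : g *m ((g^-1)%g *m u) = u.
Proof. by rewrite mulmxA gl_mxV mul1mx. Qed.

Lemma defectV g u : defect (g^-1)%g u = - defect g ((g^-1)%g *m u).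
Proof. by rewrite /defect gl_mulmxK opprB. Qed.

Lemma GU1 : GU n (1%g : GL (n + n) A).
Proof. by split=> [u v|u]; rewrite !mul1mx. Qed.

Lemma GU_div g k : GU n g -> GU n k -> GU n (g * k^-1)%g.
Proof.
move=> [gh gq] [kh kq]; split=> [u v|u]; rewrite -!mulmxA.
  by rewrite gh -kh !gl_mulmxK.
by rewrite gq -kq gl_mulmxK.
Qed.

Lemma GU_congrP X g :
  GU_congr n X g <-> [/\ GU n g, forall i j, fideal X ((gl_mx g - 1%:M) i j) &
    forall u, fparam X (defect g u)].
Proof.
split=> [gX|[gU gi gd]].
  by split; [case: gX | case: gX | move=> u; exact: GU_congr_defect].
by split=> // u; exists (defect g u) => //; rewrite /defect addrC subrK.
Qed.

Lemma GU_congr_group X : group_closed [in GU_congr n X].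
Proof.
have /zmod_setP[P0 PB] := fparam_zmod X.
have /zmod_setP[X0 XB] := fideal_zmod X.
split=> [|g k /set_mem/GU_congrP[gU gi gd] /set_mem/GU_congrP[kU ki kd]];
  apply/mem_set/GU_congrP.
  split; first exact: GU1.
    by move=> i j; rewrite subrr mxE.
  by move=> u; rewrite /defect mul1mx subrr.
split.
- exact: GU_div.
- move=> i j.
  have -> : gl_mx (g * k^-1)%g - 1%:M =
     ((gl_mx g - 1%:M) - (gl_mx k - 1%:M)) *m (k^-1)%g.
    rewrite opprB addrA subrK mulmxBl; congr (_ - _).
    by rewrite -[RHS]mulmx1 -mulmxA gl_mulmxK.
  apply: mulmx_in => [|{}i {}j l]; first exact: fideal_zmod.
  by apply: fidealMr; rewrite mxE [X in _ + X]mxE; apply: XB.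
- by move=> u; rewrite defectM defectV; exact: PB.
Qed.

Lemma GU_congr_comm X Y g k : GU_congr n X g -> GU_congr n Y k ->
  GU_congr n (fi_symprod X Y) (g * k * g^-1 * k^-1)%g.
Proof.
move=> gX kY; have [[gU gi _] [kU ki _]] := (gX, kY).
have Kz := fideal_zmod (fi_symprod X Y); have /zmod_setP[_ KB] := Kz.
apply/GU_congrP; split; first do 2!apply: GU_div => //.
  (* gk = g (1 k^-1)^-1 *)
  by rewrite -[k]invgK -[(k^-1)%g]mul1g; do 2!apply: GU_div => //; exact: GU1.
- (* The linear terms of gk - kg = (g - 1)(k - 1) - (k - 1)(g - 1) cancel. *)
  move=> i j; set c := (_ * k^-1)%g.
  have subM1 (P Q : 'M[A]_(n + n)) :
      (P - 1%:M) *m (Q - 1%:M) = P *m Q - (P + Q - 1%:M).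
    by rewrite mulmxBl mulmxBr mul1mx mulmx1 -!addrA -opprD.
  have -> : gl_mx c - 1%:M =
     ((gl_mx g - 1%:M) *m (gl_mx k - 1%:M) -
      (gl_mx k - 1%:M) *m (gl_mx g - 1%:M)) *m (g^-1 * k^-1)%g.
    rewrite !subM1 (addrC (gl_mx k)); move: (gl_mx g + _ - _) => s.
    rewrite opprB addrA subrK mulmxBl.
    by congr (_ - _); rewrite ?mulmxA // -!mulmxA gl_mulmxK gl_mxV.
  apply: mulmx_in => // {}i {}j l; apply: fidealMr.
  rewrite mxE [X in _ + X]mxE.
  by apply: KB; apply: mulmx_in => // ? ? ?;
    [apply: fideal_symprodl | apply: fideal_symprodr].
- (* The commutator maps kgw = u to gkw. *)
  move=> u; pose w := ((k * g)^-1)%g *m u.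
  have -> : defect (g * k * g^-1 * k^-1)%g u =
     (defect g (k *m w) - defect g w) - (defect k (g *m w) - defect k w).
    rewrite -mulgA -invgM defectM defectV -/w !defectM.
    by rewrite (opprB (defect k _)) (opprD (defect k _)) [X in _ + X = _]addrC [LHS]addrACA.
  have /zmod_setP[_ PB] := fparam_zmod (fi_symprod X Y).
  apply: PB; first exact: defect_shift_in.
  by rewrite fparam_symprodC; apply: defect_shift_in.
Qed.

End Forms.

Theorem lemma8 (n : nat) (n_ge3 : (3 <= n)%N) (A : formRing)
    (X Y : formIdeal A) :
  comm_subgroup (GU_congr n X) (GU_congr n Y) `<=` GU_congr n (fi_symprod X Y).
Proof.
apply: smallest_sub; first exact: GU_congr_group.
by move=> _ [g gX [k kY <-]]; apply: GU_congr_comm.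
Qed.
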